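(* Let $\gamma=(\gamma_{ij}(x))$ be a projectively flat Riemannian metric on $M$ and let $\alpha=\alpha(x,y)$ be a homogeneous polynomial function in $y$ of degree $m>0$ with $\alpha_{;i}=0$ for $i=1,\dots,n$, where the covariant derivative $;$ is taken with respect to the canonical connection arising from $\gamma$. Then the root metric $F$ (of order $m+2$) defined by $$F^{m+2}=\bar T=\alpha(x,y)\,\gamma_{ij}(x)y^iy^j$$ is projectively flat.
   Context: Let $M$ be a smooth $n$-dimensional manifold with induced coordinates $(x^i,y^i)$ on $TM$. A root metric of order $k\ge 2$ is $F=\sqrt[k]{a_{i_1\dots i_k}(x)y^{i_1}\cdots y^{i_k}}$, $a_{i_1\dots i_k}$ totally symmetric, such that $g_{ij}=\frac12\frac{\partial^2F^2}{\partial y^i\partial y^j}$ is nondegenerate on $TM\setminus\{0\}$ (at the points where $F$ is defined and smooth); it is part of the hypothesis that the $F$ of the statement is such a metric. For the Riemannian metric $\gamma$ with Christoffel symbols $\Gamma^i_{\ jk}(x)$ the canonical nonlinear connection is $N^i_{\ j}=\Gamma^i_{\ jk}y^k$, and $\alpha_{;i}=\frac{\partial\alpha}{\partial x^i}-N^r_{\ i}\frac{\partial\alpha}{\partial y^r}$. A Finsler (or Riemannian) metric is projectively flat if its geodesics are straight lines, i.e. around every point there is a coordinate system in which the geodesics are, as point sets, straight lines. *)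

(* Defs.v *)
From HB Require Import structures.
From mathcomp Require Import all_boot all_order all_algebra.
From mathcomp Require Import all_classical all_reals all_analysis.

Set Implicit Arguments.
Unset Strict Implicit.
Unset Printing Implicit Defensive.

Import Order.TTheory GRing.Theory Num.Theory.
Import numFieldNormedType.Exports.

Local Open Scope classical_set_scope.
Local Open Scope ring_scope.

(* C^k and C^oo maps on an open set U of a finite-dimensional space, by
   iterated directional derivatives along constant directions. *)
Fixpoint Ck_on (R : realType) (V W : normedModType R) (k : nat) (U : set V)
    (f : V -> W) : Prop :=
  (forall x, U x -> {for x, continuous f}) /\
  (if k is k'.+1 then
     forall v, (forall x, U x -> derivable f x v) /\ Ck_on k' U ('D_v f)
   else True).

Definition smooth_on (R : realType) (V W : normedModType R) (U : set V)
    (f : V -> W) : Prop := forall k, Ck_on k U f.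

(* The total functions [cmap] and [cinv] are only meaningful on [cdom] and
   [cmap @` cdom] respectively. *)
Record chart (R : realType) (n : nat) (M : topologicalType) := Chart {
  cdom : set M;
  cmap : M -> 'rV[R]_n;
  cinv : 'rV[R]_n -> M;
  cdom_open : open cdom;
  cimg_open : open (cmap @` cdom);
  cmap_cont : {within cdom, continuous cmap};
  cinv_cont : {within cmap @` cdom, continuous cinv};
  cmapK : forall p, cdom p -> cinv (cmap p) = p }.

Definition cimg (R : realType) n (M : topologicalType) (phi : chart R n M) :
  set 'rV[R]_n := cmap phi @` cdom phi.

Definition transition (R : realType) n (M : topologicalType)
    (phi psi : chart R n M) : 'rV[R]_n -> 'rV[R]_n := cmap psi \o cinv phi.

Definition compatible (R : realType) n (M : topologicalType)
    (phi psi : chart R n M) : Prop :=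
  smooth_on (cmap phi @` (cdom phi `&` cdom psi)) (transition phi psi) /\
  smooth_on (cmap psi @` (cdom phi `&` cdom psi)) (transition psi phi).

(* A is the maximal atlas (the set of all coordinate systems) of a smooth
   n-dimensional manifold structure on M. *)
Record smooth_manifold (R : realType) n (M : topologicalType)
    (A : set (chart R n M)) : Prop := SmoothManifold {
  manifold_hausdorff : hausdorff_space M;
  manifold_countable : @second_countable M;
  atlas_cover : forall p : M, exists2 phi, A phi & cdom phi p;
  atlas_compat : forall phi psi, A phi -> A psi -> compatible phi psi;
  atlas_maximal : forall phi,
    (forall psi, A psi -> compatible phi psi) -> A phi }.

(* Induced coordinates z = (x, y) on TM: z.1 = x, z.2 = y. *)
Notation tcoord R n := ('rV[R]_n * 'rV[R]_n)%type.

Definition timg (R : realType) n (M : topologicalType) (phi : chart R n M) :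
  set (tcoord R n) := [set z | cimg phi z.1].

Definition basis_vec (R : realType) n (i : 'I_n) : 'rV[R]_n := delta_mx 0 i.

Definition dx (R : realType) n (i : 'I_n) (f : tcoord R n -> R^o) :
  tcoord R n -> R^o := 'D_((basis_vec R i, 0) : tcoord R n) f.

Definition dy (R : realType) n (i : 'I_n) (f : tcoord R n -> R^o) :
  tcoord R n -> R^o := 'D_((0, basis_vec R i) : tcoord R n) f.

(* Objects on M and TM are given by their expressions in all charts of the
   atlas; a tangent vector y transforms by the differential of the change of
   coordinates. *)
Definition TM_function (R : realType) n (M : topologicalType)
    (A : set (chart R n M)) (f : chart R n M -> tcoord R n -> R^o) : Prop :=
  forall phi psi p y, A phi -> A psi -> cdom phi p -> cdom psi p ->
    f psi (cmap psi p, 'D_y (transition phi psi) (cmap phi p))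
    = f phi (cmap phi p, y).

(* f(x,y) = a_{i_1...i_k}(x) y^{i_1} ... y^{i_k} *)
Definition form_of (R : realType) n k
    (a : k.-tuple 'I_n -> 'rV[R]_n -> R^o) (z : tcoord R n) : R^o :=
  \sum_(I : k.-tuple 'I_n) a I z.1 * \prod_(j < k) z.2 0 (tnth I j).

Definition homogeneous_polynomial (R : realType) n (M : topologicalType)
    (A : set (chart R n M)) (m : nat)
    (alpha : chart R n M -> tcoord R n -> R^o) : Prop :=
  TM_function A alpha /\
  forall phi, A phi -> exists a : m.-tuple 'I_n -> 'rV[R]_n -> R^o,
    (forall I, smooth_on (cimg phi) (a I)) /\
    (forall z, timg phi z -> alpha phi z = form_of a z).

Definition bilin (R : realType) n (B : 'M[R]_n) (u v : 'rV[R]_n) : R :=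
  (u *m B *m v^T) 0 0.

Record riemannian_metric (R : realType) n (M : topologicalType)
    (A : set (chart R n M)) (gamma : chart R n M -> 'rV[R]_n -> 'M[R]_n) :
    Prop := RiemannianMetric {
  metric_smooth : forall phi i j, A phi ->
    smooth_on (cimg phi) ((fun x => gamma phi x i j) : 'rV[R]_n -> R^o);
  metric_sym : forall phi x, A phi -> cimg phi x ->
    (gamma phi x)^T = gamma phi x;
  metric_posdef : forall phi x y, A phi -> cimg phi x -> y != 0 ->
    0 < bilin (gamma phi x) y y;
  metric_tensor : forall phi psi p u v, A phi -> A psi ->
    cdom phi p -> cdom psi p ->
    bilin (gamma psi (cmap psi p))
      ('D_u (transition phi psi) (cmap phi p))
      ('D_v (transition phi psi) (cmap phi p))
    = bilin (gamma phi (cmap phi p)) u v }.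

(* Gamma^i_{jk} of a metric given in coordinates by g *)
Definition christoffel (R : realType) n (g : 'rV[R]_n -> 'M[R]_n)
    (i j k : 'I_n) (x : 'rV[R]_n) : R :=
  let d l r s : R :=
    'D_(basis_vec R l) ((fun x' => g x' r s) : 'rV[R]_n -> R^o) x in
  2^-1 * \sum_l invmx (g x) i l * (d j l k + d k l j - d l j k).

(* N^i_j = Gamma^i_{jk}(x) y^k *)
Definition canonical_connection (R : realType) n (g : 'rV[R]_n -> 'M[R]_n)
    (i j : 'I_n) (z : tcoord R n) : R :=
  \sum_k christoffel g i j k z.1 * z.2 0 k.

(* f_{;i} *)
Definition covariant_derivative (R : realType) n (g : 'rV[R]_n -> 'M[R]_n)
    (f : tcoord R n -> R^o) (i : 'I_n) (z : tcoord R n) : R :=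
  dx i f z - \sum_r canonical_connection g r i z * dy r f z.

(* Regular curves c : ]a,b[ -> M whose velocity stays in the domain D of the
   spray and which satisfy, in all coordinates, c'' + 2 G(c, c') = 0. *)
Definition geodesic (R : realType) n (M : topologicalType)
    (A : set (chart R n M)) (D : chart R n M -> set (tcoord R n))
    (G : chart R n M -> tcoord R n -> 'rV[R]_n)
    (a b : R) (c : R -> M) : Prop :=
  {within `]a, b[, continuous c} /\
  forall phi t, A phi -> t \in `]a, b[ -> cdom phi (c t) ->
    let x : R -> 'rV[R]_n := cmap phi \o c in
    let x' := derive1 x in
    [/\ derivable x t 1, derivable x' t 1, D phi (x t, x' t) &
        derive1 x' t + 2 *: G phi (x t, x' t) = 0].

(* S is, as a point set, a straight line (or a piece of one). *)
Definition straight (R : realType) n (S : set 'rV[R]_n) : Prop :=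
  exists (p v : 'rV[R]_n) (J : interval R),
    v != 0 /\ S = [set p + s *: v | s in [set` J]].

Definition projectively_flat (R : realType) n (M : topologicalType)
    (A : set (chart R n M)) (D : chart R n M -> set (tcoord R n))
    (G : chart R n M -> tcoord R n -> 'rV[R]_n) : Prop :=
  forall p : M, exists phi, [/\ A phi, cdom phi p &
    forall (a b : R) (c : R -> M), a < b -> geodesic A D G a b c ->
      c @` `]a, b[ `<=` cdom phi ->
      straight ((cmap phi \o c) @` `]a, b[)].

Definition slit (R : realType) n : set (tcoord R n) := [set z | z.2 != 0].

(* 2 G^i = Gamma^i_{jk}(x) y^j y^k *)
Definition riemannian_spray (R : realType) n (g : 'rV[R]_n -> 'M[R]_n)
    (z : tcoord R n) : 'rV[R]_n :=
  \row_i (2^-1 * \sum_j \sum_k christoffel g i j k z.1 * z.2 0 j * z.2 0 k).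

Definition riemannian_projectively_flat (R : realType) n
    (M : topologicalType) (A : set (chart R n M))
    (gamma : chart R n M -> 'rV[R]_n -> 'M[R]_n) : Prop :=
  projectively_flat A (fun=> @slit R n) (fun phi => riemannian_spray (gamma phi)).

Definition fundamental_tensor (R : realType) n (F : tcoord R n -> R^o)
    (z : tcoord R n) : 'M[R]_n :=
  \matrix_(i, j) (2^-1 * dy i (dy j (fun w => F w ^+ 2)) z).

(* G^i = 1/4 g^{il} ([F^2]_{x^k y^l} y^k - [F^2]_{x^l}) *)
Definition finsler_spray (R : realType) n (F : tcoord R n -> R^o)
    (z : tcoord R n) : 'rV[R]_n :=
  let L : tcoord R n -> R^o := fun w => F w ^+ 2 in
  \row_i (4^-1 * \sum_l invmx (fundamental_tensor F z) i l *
            (\sum_k dy l (dx k L) z * z.2 0 k - dx l L z)).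

(* Points of TM \ {0}, read in the chart phi, near which F is defined
   (E being its set of definition) and smooth. *)
Definition regular_points (R : realType) n (M : topologicalType)
    (phi : chart R n M) (E : set (tcoord R n)) (F : tcoord R n -> R^o) :
    set (tcoord R n) :=
  [set z : tcoord R n | z.2 != 0 /\ exists O : set (tcoord R n),
    [/\ open_nbhs z O, O `<=` timg phi, O `<=` E & smooth_on O F]].

(* The real k-th root: defined everywhere for odd k, on t >= 0 for even k. *)
Definition root_defined (R : realType) (k : nat) (t : R) : bool :=
  odd k || (0 <= t).

Definition kroot (R : realType) (k : nat) (t : R) : R :=
  if 0 <= t then t `^ k%:R^-1 else - ((- t) `^ k%:R^-1).

Section RootMetric.
Variables (R : realType) (n : nat) (M : topologicalType).
Variables (A : set (chart R n M)) (k : nat).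
Variable T : chart R n M -> tcoord R n -> R^o.

Definition root_function (phi : chart R n M) : tcoord R n -> R^o :=
  fun z => kroot k (T phi z).

Definition root_regular (phi : chart R n M) : set (tcoord R n) :=
  regular_points phi [set z | root_defined k (T phi z)] (root_function phi).

(* F = T^(1/k) is a root metric of order k. *)
Record root_metric : Prop := RootMetric {
  root_order : (2 <= k)%N;
  root_TM : TM_function A T;
  root_form : forall phi, A phi ->
    exists a : k.-tuple 'I_n -> 'rV[R]_n -> R^o,
    [/\ forall I, smooth_on (cimg phi) (a I),
        forall (I J : k.-tuple 'I_n) x, perm_eq I J -> a I x = a J x &
        forall z, timg phi z -> T phi z = form_of a z];
  root_nondegenerate : forall phi z, A phi -> root_regular phi z ->
    fundamental_tensor (root_function phi) z \in unitmx }.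

Definition root_projectively_flat : Prop :=
  projectively_flat A root_regular (fun phi => finsler_spray (root_function phi)).

End RootMetric.

(* Main.v *)
Require Import Defs.
From HB Require Import structures.
From mathcomp Require Import all_boot all_order all_algebra.
From mathcomp Require Import all_classical all_reals all_analysis.
From mathcomp Require Import ring.
Import Order.TTheory GRing.Theory Num.Theory.
Import numFieldNormedType.Exports.
Local Open Scope classical_set_scope.
Local Open Scope ring_scope.

(* In every chart the spray of [F] coincides with the spray of [gamma] at all
   regular points, so geodesics of [F] are geodesics of [gamma].  Metric
   compatibility gives [gamma(y, y)_;i = 0], hence [(F ^+ k)_;i = 0] and, near a
   regular point, [L_;i = 0] for [L = F ^+ 2], that is
   [L_{x^i} = N^r_i L_{y^r}].  Differentiating in [y] and using the symmetry of
   the Christoffel symbols,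
   [L_{x^k y^l} y^k - L_{x^l} = 2 g_{lr} N^r_k y^k], and inverting [g]
   yields [2 G^i = N^i_k y^k]. *)

(** * Directional derivatives of quadratic forms in induced coordinates *)

(** For [h != 0] the difference quotient is exactly [c + h * d]. This handles every function that is
    constant, affine or quadratic along a line. *)
Lemma is_derive_poly2 (R : realType) (V : normedModType R) (f : V -> R^o)
    (z v : V) (c d : R) :
  (forall h : R, f (h *: v + z) = f z + h * c + h ^+ 2 * d) ->
  is_derive z v f c.
Proof.
move=> fE.
have lim_c : (fun h : R => h^-1 *: ((f \o shift z) (h *: v) - f z)) @ 0^' -->
    (c : R^o).
  apply: (@cvg_trans _ ((fun h : R => c + h * d : R^o) @ 0^')).
    apply: near_eq_cvg; near=> h.
    have h0 : h != 0 by near: h; exact: nbhs_dnbhs_neq.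
    by rewrite /= fE /GRing.scale /=; by field.
  suff : (fun h : R => c + h * d : R^o) @ 0^' --> (c + 0 * d : R^o).
    by rewrite mul0r addr0.
  apply: cvg_within_filter.
  by apply: cvgD; [exact: cvg_cst | apply: cvgMl; exact: cvg_id].
apply: DeriveDef; last exact: cvg_lim lim_c.
by apply/cvg_ex; exists c.
Unshelve. all: by end_near. Qed.

(** The two difference quotients are convertible: the first component of [h *: (v, 0) + z] computes
    to [h *: v + z.1]. *)
Lemma is_derive_fst (R : realType) (V W : normedModType R) (f : V -> R^o)
    (z : V * W) (v : V) (df : R^o) :
  is_derive z.1 v f df -> is_derive z ((v, 0) : V * W) (fun w => f w.1) df.
Proof. by move=> [dfx dfE]; split. Qed.

Lemma is_derive_fst0 (R : realType) (V W : normedModType R) (f : V -> R^o)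
    (z : V * W) (u : W) : is_derive z ((0, u) : V * W) (fun w => f w.1) 0.
Proof.
apply: (@is_derive_poly2 _ _ _ _ _ 0 0) => h /=.
by rewrite scaler0 add0r !mulr0 !addr0.
Qed.

Lemma bilin_sum (R : realType) n (B : 'M[R]_n) (u v : 'rV[R]_n) :
  bilin B u v = \sum_i \sum_j B i j * u 0 i * v 0 j.
Proof.
rewrite /bilin mxE exchange_big; apply: eq_bigr => j _.
by rewrite !mxE big_distrl; apply: eq_bigr => i _ /=; rewrite (mulrC (u 0 i)).
Qed.

Lemma bilin_sym (R : realType) n (B : 'M[R]_n) (u v : 'rV[R]_n) :
  B^T = B -> bilin B u v = bilin B v u.
Proof.
move=> BT; rewrite !bilin_sum exchange_big; apply: eq_bigr => i _.
by apply: eq_bigr => j _; rewrite -{1}BT mxE mulrAC.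
Qed.

(** A nonzero [v] in the left kernel would give [bilin B v v = 0]. *)
Lemma posdef_unitmx (R : realType) n (B : 'M[R]_n) :
  (forall y, y != 0 -> 0 < bilin B y y) -> B \in unitmx.
Proof.
move=> Bpos; rewrite -row_free_unit -kermx_eq0.
apply/negPn/negP => /rowV0Pn[v /sub_kermxP vB v0].
by move: (Bpos v v0); rewrite /bilin vB mul0mx mxE ltxx.
Qed.

Lemma is_derive_bilin_x (R : realType) n (g : 'rV[R]_n -> 'M[R]_n)
    (z : tcoord R n) (v : 'rV[R]_n) :
  (forall i j, derivable ((fun x => g x i j) : 'rV[R]_n -> R^o) z.1 v) ->
  is_derive z ((v, 0) : tcoord R n) (fun w : tcoord R n => bilin (g w.1) w.2 w.2 : R^o)
    (\sum_i \sum_j 'D_v ((fun x => g x i j) : 'rV[R]_n -> R^o) z.1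
       * z.2 0 i * z.2 0 j).
Proof.
move=> dg.
have -> : (fun w : tcoord R n => bilin (g w.1) w.2 w.2 : R^o) =
    \sum_i \sum_j (fun w : tcoord R n => g w.1 i j * w.2 0 i * w.2 0 j : R^o).
  apply/funext => w; rewrite bilin_sum fct_sumE; apply: eq_bigr => i _.
  by rewrite fct_sumE.
apply: is_derive_sum => i; apply: is_derive_sum => j.
have dy2 k : is_derive z ((v, 0) : tcoord R n) (fun w : tcoord R n => w.2 0 k : R^o) 0.
  apply: (@is_derive_poly2 _ _ _ _ _ 0 0) => h /=.
  by rewrite scaler0 add0r !mulr0 !addr0.
have dgz := @is_derive_fst _ _ _ _ z v _ (derivableP (dg i j)).
have d1 := is_deriveM dgz (dy2 i); have d2 := is_deriveM d1 (dy2 j).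
apply: is_derive_eq d2 _.
by rewrite /GRing.scale /= !mulr0 !add0r mulrC; congr (_ * _); rewrite mulrC.
Qed.

(** Moving [y] by [h *: e] adds [h (B(e,y) + B(y,e)) + h^2 B(e,e)]; symmetry merges the two cross
    terms into the factor 2. *)
Lemma is_derive_bilin_y (R : realType) n (g : 'rV[R]_n -> 'M[R]_n)
    (z : tcoord R n) (r : 'I_n) :
  (g z.1)^T = g z.1 ->
  is_derive z ((0, basis_vec R r) : tcoord R n)
    (fun w : tcoord R n => bilin (g w.1) w.2 w.2 : R^o)
    (2 * \sum_s g z.1 r s * z.2 0 s).
Proof.
move=> gT; set e := basis_vec R r; set B := g z.1.
have Be : \sum_s B r s * z.2 0 s = bilin B e z.2.
  by rewrite /bilin /e /basis_vec -rowE mxE; apply: eq_bigr => s _; rewrite !mxE.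
apply: (@is_derive_poly2 _ _ _ _ _ _ (bilin B e e)) => h /=.
rewrite scaler0 add0r -/B Be /bilin linearD /= linearZ /=.
have := bilin_sym _ _ _ z.2 e gT; rewrite -/B /bilin => Bze.
rewrite mulmxDl mulmxDr !mulmxDl -!scalemxAl -!scalemxAr.
have addE (X Y : 'M[R]_1) : (X + Y) 0 0 = X 0 0 + Y 0 0 by rewrite mxE.
have scaleE (a : R) (X : 'M[R]_1) : (a *: X) 0 0 = a * X 0 0 by rewrite mxE.
rewrite !(addE, scaleE) Bze; ring.
Qed.

Lemma near_slit (R : realType) n (z : tcoord R n) :
  z.2 != 0 -> \forall w \near z, w.2 != 0.
Proof.
move=> z0.
have oS : open [set y : 'rV[R]_n | y != 0].
  rewrite (_ : [set y | _] = ~` [set 0]); last first.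
    by apply/seteqP; split => y /= /eqP.
  apply/closed_openC/accessible_closed_set1/hausdorff_accessible.
  exact: norm_hausdorff.
case: z z0 => x y /= y0.
apply: (@cvg_snd _ _ (nbhs x) (nbhs y) _ [set y : 'rV[R]_n | y != 0]).
exact: open_nbhs_nbhs.
Qed.

(** * Christoffel symbols and metric compatibility *)

(** The first two terms trade places. The third differentiates an entry of [g], so symmetry is
    assumed on a neighbourhood of [x]. *)
Lemma christoffelC (R : realType) n (g : 'rV[R]_n -> 'M[R]_n)
    (i j k : 'I_n) (x : 'rV[R]_n) :
  (\forall x' \near x, (g x')^T = g x') ->
  christoffel g i j k x = christoffel g i k j x.
Proof.
move=> gT; rewrite /christoffel; congr (_ * _); apply: eq_bigr => l _.
congr (_ * (_ - _)); first exact: addrC.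
apply: near_eq_derive; near=> x'.
have /matrixP/(_ k j) : (g x')^T = g x' by near: x'.
by rewrite mxE.
Unshelve. all: by end_near. Qed.

(** Lowering the upper index cancels the inverse matrix and leaves the Christoffel symbols of the
    first kind. *)
Lemma christoffel_lower (R : realType) n (g : 'rV[R]_n -> 'M[R]_n)
    (k j s : 'I_n) (x : 'rV[R]_n) :
  let d l r s : R :=
    'D_(basis_vec R l) ((fun x' => g x' r s) : 'rV[R]_n -> R^o) x in
  (g x)^T = g x -> g x \in unitmx ->
  \sum_r christoffel g r k j x * g x r s = 2^-1 * (d k s j + d j s k - d s k j).
Proof.
move=> d gT gU; set c := fun l => d k l j + d j l k - d l k j.
transitivity (2^-1 * \sum_l (\sum_r g x s r * invmx (g x) r l) * c l).
  under [in RHS]eq_bigr do rewrite big_distrl /=.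
  rewrite exchange_big big_distrr /=; apply: eq_bigr => r _.
  rewrite /christoffel -mulrA big_distrl /=; congr (_ * _).
  by apply: eq_bigr => l _; rewrite -{2}gT mxE -/(c l); ring.
have VE a b : \sum_r g x a r * invmx (g x) r b = (a == b)%:R.
  by have /matrixP/(_ a b) := mulmxV gU; rewrite !mxE.
under eq_bigr do rewrite VE.
rewrite (bigD1 s) //= big1 => [|l /negbTE ls]; first by rewrite eqxx mul1r addr0.
by rewrite eq_sym ls mul0r.
Qed.

(** This is the vanishing of the covariant derivative of the metric, contracted twice with [y]. The
    factor 2 from the [y]-derivative cancels the [2^-1] of the lowered symbols. *)
Lemma metric_compatible (R : realType) n (g : 'rV[R]_n -> 'M[R]_n)
    (k : 'I_n) (z : tcoord R n) :
  (\forall x \near z.1, (g x)^T = g x) -> g z.1 \in unitmx ->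
  (forall i j, derivable ((fun x => g x i j) : 'rV[R]_n -> R^o) z.1
     (basis_vec R k)) ->
  covariant_derivative g (fun w => bilin (g w.1) w.2 w.2) k z = 0.
Proof.
move=> gTn gU dg; have gT := nbhs_singleton gTn.
have [_ dxE] := is_derive_bilin_x _ _ _ _ _ dg.
rewrite /covariant_derivative /dx dxE; apply/eqP; rewrite subr_eq0; apply/eqP.
under [RHS]eq_bigr => r _.
  rewrite /dy; have [_ ->] := is_derive_bilin_y _ _ g z r gT.
  over.
set d := fun l r s : 'I_n => (
  'D_(basis_vec R l) ((fun x' => g x' r s) : 'rV[R]_n -> R^o) z.1 : R).
transitivity (\sum_s \sum_j (d k s j + d j s k - d s k j) *
    z.2 0 s * z.2 0 j).
  have dC l r s : d l r s = d l s r.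
    apply: near_eq_derive; near=> x'.
    have /matrixP/(_ s r) : (g x')^T = g x' by near: x'.
    by rewrite mxE.
  (* The last two terms of the lowered symbol are exchanged by swapping [s] and [j], so they cancel
     against the symmetric [y^s y^j]. *)
  have : \sum_s \sum_j d j s k * z.2 0 s * z.2 0 j =
         \sum_s \sum_j d s k j * z.2 0 s * z.2 0 j.
    rewrite exchange_big; apply: eq_bigr => s _; apply: eq_bigr => j _.
    by rewrite (dC _ j) mulrAC.
  move/eqP; rewrite -subr_eq0 => /eqP e.
  rewrite -[LHS]addr0 -[X in _ + X]e -sumrB -big_split.
  apply: eq_bigr => s _ /=.
  rewrite -sumrB -big_split; apply: eq_bigr => j _ /=; rewrite -/(d k s j).
  by ring.
transitivity (\sum_s \sum_r \sum_j christoffel g r k j z.1 * z.2 0 j *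
    (2 * (g z.1 r s * z.2 0 s))).
  apply: eq_bigr => s _; rewrite exchange_big; apply: eq_bigr => j _ /=.
  transitivity ((2 * \sum_r christoffel g r k j z.1 * g z.1 r s) *
      z.2 0 s * z.2 0 j).
    by rewrite christoffel_lower // -!/(d _ _ _); field.
  rewrite mulr_sumr 2!mulr_suml; apply: eq_bigr => r _; ring.
rewrite exchange_big /=; apply: eq_bigr => r _.
rewrite 2!mulr_sumr; apply: eq_bigr => s _.
by rewrite /canonical_connection mulr_suml.
Unshelve. all: by end_near. Qed.

(** * From horizontal constancy of [F ^+ 2] to equality of sprays *)

Lemma is_derive_canonical_connection (R : realType) n
    (g : 'rV[R]_n -> 'M[R]_n) (i j l : 'I_n) (z : tcoord R n) :
  is_derive z ((0, basis_vec R l) : tcoord R n)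
    (canonical_connection g i j : tcoord R n -> R^o)
    (christoffel g i j l z.1).
Proof.
apply: (@is_derive_poly2 _ _ _ _ _ _ 0) => h /=.
rewrite /canonical_connection /= mulr0 addr0 scaler0 add0r.
under eq_bigr do rewrite !mxE mulrDr eqxx /=.
rewrite big_split /= addrC; congr (_ + _).
rewrite (bigD1 l) //= big1 => [|s /negbTE sl]; last by rewrite sl !mulr0.
by rewrite eqxx mulr1 addr0 mulrC.
Qed.

(** The equation [L_;i = 0] is assumed near [z], not just at [z], because it gets differentiated in
    [y]. *)
Lemma finsler_spray_riemannian (R : realType) n (g : 'rV[R]_n -> 'M[R]_n)
    (F : tcoord R n -> R^o) (z : tcoord R n) :
  let L : tcoord R n -> R^o := fun w => F w ^+ 2 in
  (\forall x \near z.1, (g x)^T = g x) ->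
  fundamental_tensor F z \in unitmx ->
  (forall i, \forall w \near z, covariant_derivative g L i w = 0) ->
  (forall r l, derivable (dy r L) z ((0, basis_vec R l) : tcoord R n)) ->
  finsler_spray F z = riemannian_spray g z.
Proof.
move=> L gT FU Lcov dyL.
have dxL k : \forall w \near z,
    dx k L w = \sum_r canonical_connection g r k w * dy r L w.
  by apply: filterS (Lcov k) => w /eqP; rewrite subr_eq0 => /eqP.
pose N r k := canonical_connection g r k z.
have dydxL l k : dy l (dx k L) z =
    \sum_r (N r k * dy l (dy r L) z + christoffel g r k l z.1 * dy r L z).
  rewrite {1}/dy (near_eq_derive _ (dxL k)).
  rewrite (_ : (fun w : tcoord R n => _) =
    \sum_r ((canonical_connection g r k : tcoord R n -> R^o) * dy r L));
    last first.
    by apply/funext => w; rewrite fct_sumE.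
  apply: derive_val; apply: is_derive_sum => r.
  have := is_deriveM (is_derive_canonical_connection _ _ g r k l z)
    (derivableP (dyL r l)).
  by move/is_derive_eq; apply; rewrite /GRing.scale /= (mulrC (christoffel _ _ _ _ _)).
pose N2 r := \sum_k N r k * z.2 0 k.
(* By symmetry of the lower indices, the Christoffel terms contract with [y^k] to [N^r_l L_{y^r}],
   which is [L_{x^l}] and cancels. The rest uses [L_{y^l y^r} = 2 g_{lr}]. *)
have sprayE l : \sum_k dy l (dx k L) z * z.2 0 k - dx l L z =
    \sum_r 2 * fundamental_tensor F z l r * N2 r.
  rewrite (nbhs_singleton (dxL l)).
  under eq_bigr do rewrite dydxL big_distrl /=.
  rewrite exchange_big -sumrB; apply: eq_bigr => r _ /=.
  rewrite /canonical_connection big_distrl -sumrB /N2 big_distrr /=.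
  apply: eq_bigr => k _; rewrite (christoffelC _ _ _ _ k l) // mxE -/L.
  by field.
apply/rowP => i; rewrite !mxE.
under eq_bigr do rewrite -/L sprayE big_distrr /=.
rewrite exchange_big /=.
(* The [4^-1] of the Finsler spray meets the 2 of [sprayE]; the inner sum is then a Kronecker
   delta. *)
transitivity (2^-1 * \sum_r (\sum_l invmx (fundamental_tensor F z) i l *
    fundamental_tensor F z l r) * N2 r).
  rewrite !big_distrr; apply: eq_bigr => r _ /=.
  rewrite big_distrl !big_distrr; apply: eq_bigr => l _ /=; by field.
have VE a b : \sum_l invmx (fundamental_tensor F z) a l *
    fundamental_tensor F z l b = (a == b)%:R.
  by have /matrixP/(_ a b) := mulVmx FU; rewrite [LHS]mxE [RHS]mxE.
rewrite [in LHS](eq_bigr (fun r => (i == r)%:R * N2 r)) => [|r _]; last first.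
  by rewrite VE.
rewrite (bigD1 i) //= big1 => [|r /negbTE ri].
  rewrite eqxx mul1r addr0; congr (_ * _); apply: eq_bigr => k _.
  rewrite /N /canonical_connection big_distrl /=; apply: eq_bigr => j _.
  by rewrite mulrAC.
by rewrite eq_sym ri mul0r.
Qed.

(** * Real roots and covariant derivatives of products and powers *)

(** For negative [t], [root_defined] forces [k] to be odd, so the sign taken out of the root
    survives the power. *)
Lemma krootK (R : realType) (k : nat) (t : R) :
  (0 < k)%N -> root_defined k t -> kroot k t ^+ k = t.
Proof.
move=> k0; have powK (s : R) : 0 <= s -> (s `^ k%:R^-1) ^+ k = s.
  move=> s0; rewrite -powR_mulrn ?powR_ge0// -powRrM mulVf ?powRr1//.
  by rewrite pnatr_eq0 -lt0n.
rewrite /root_defined /kroot; have [t0 _|t0] := leP 0 t; first exact: powK.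
rewrite orbF => kodd.
by rewrite exprNn powK ?oppr_ge0 ?ltW// -signr_odd kodd expr1 mulN1r opprK.
Qed.

(** These partial derivatives are exactly the ones entering [covariant_derivative]. *)
Definition coord_derivable {R : realType} {n} (f : tcoord R n -> R^o)
    (z : tcoord R n) : Prop := forall i : 'I_n,
  derivable f z ((basis_vec R i, 0) : tcoord R n) /\
  derivable f z ((0, basis_vec R i) : tcoord R n).

Lemma covariant_derivativeM (R : realType) n (g : 'rV[R]_n -> 'M[R]_n)
    (f h : tcoord R n -> R^o) (i : 'I_n) (z : tcoord R n) :
  coord_derivable f z -> coord_derivable h z ->
  covariant_derivative g (f * h) i z =
  f z * covariant_derivative g h i z + h z * covariant_derivative g f i z.
Proof.
move=> df dh; rewrite /covariant_derivative /dx /dy.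
rewrite deriveM; [|exact: (df i).1|exact: (dh i).1].
rewrite (eq_bigr (fun r =>
    f z * (canonical_connection g r i z * dy r h z) +
    h z * (canonical_connection g r i z * dy r f z))) => [|r _]; last first.
  rewrite deriveM; [|exact: (df r).2|exact: (dh r).2].
  by rewrite /GRing.scale /= /dy; ring.
by rewrite big_split /= -!mulr_sumr /GRing.scale /= /dy; ring.
Qed.

Lemma covariant_derivativeX (R : realType) n (g : 'rV[R]_n -> 'M[R]_n)
    (f : tcoord R n -> R^o) (i : 'I_n) (z : tcoord R n) (k : nat) :
  coord_derivable f z ->
  covariant_derivative g (f ^+ k) i z =
  k%:R * f z ^+ k.-1 * covariant_derivative g f i z.
Proof.
move=> df; rewrite /covariant_derivative /dx /dy.
rewrite deriveX; last exact: (df i).1.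
rewrite (eq_bigr (fun r => k%:R * f z ^+ k.-1 *
    (canonical_connection g r i z * dy r f z))) => [|r _]; last first.
  rewrite deriveX; last exact: (df r).2.
  by rewrite /GRing.scale /= /dy; ring.
by rewrite -mulr_sumr mulrBr.
Qed.

Lemma near_eq_covariant_derivative (R : realType) n (g : 'rV[R]_n -> 'M[R]_n)
    (f h : tcoord R n -> R^o) (i : 'I_n) (z : tcoord R n) :
  {near z, f =1 h} ->
  covariant_derivative g f i z = covariant_derivative g h i z.
Proof.
move=> fh; rewrite /covariant_derivative /dx (near_eq_derive _ fh).
congr (_ - _); apply: eq_bigr => r _.
by rewrite /dy (near_eq_derive _ fh).
Qed.

(* At zeros of [F] the factor [F] in [(F ^+ 2)_;i = 2 F F_;i] suffices, at other
   points [F_;i] vanishes because [(F ^+ k)_;i = k F ^+ (k - 1) F_;i] does. *)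
Lemma covariant_derivative_sqr_root (R : realType) n
    (g : 'rV[R]_n -> 'M[R]_n) (F a q : tcoord R n -> R^o) (k : nat)
    (i : 'I_n) (z : tcoord R n) :
  (0 < k)%N ->
  (\forall w \near z, F w ^+ k = a w * q w) ->
  (\forall w \near z, q w != 0) ->
  coord_derivable F z -> coord_derivable q z ->
  covariant_derivative g a i z = 0 -> covariant_derivative g q i z = 0 ->
  covariant_derivative g (F ^+ 2) i z = 0.
Proof.
move=> k0 Fk q0 dF dq a_i q_i.
(* Derivability of [a] is recovered from that of [F] and [q], as [a = F ^+ k / q] near [z]. *)
have da : coord_derivable a z.
  have aE : {near z, F ^+ k * (fun w => (q w)^-1) =1 a}.
    apply: filterS2 Fk q0 => w Fkw q0w.
    by rewrite exprfctE mulrfctE /= Fkw mulfK.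
  have qz0 := nbhs_singleton q0.
  move=> j; have [dFx dFy] := dF j; have [dqx dqy] := dq j.
  split; apply: near_eq_derivable aE _; apply: derivableM.
  - exact: (@derivableX _ _ F k _ _ dFx).
  - exact: (derivableV qz0 dqx).
  - exact: (@derivableX _ _ F k _ _ dFy).
  - exact: (derivableV qz0 dqy).
have : covariant_derivative g (F ^+ k) i z = 0.
  rewrite (near_eq_covariant_derivative _ _ _ _ (a * q)); last first.
    by apply: filterS Fk => w; rewrite exprfctE.
  by rewrite covariant_derivativeM // a_i q_i !mulr0 addr0.
rewrite !covariant_derivativeX // => /eqP; rewrite !mulf_eq0 pnatr_eq0 eqn0Ngt k0.
rewrite /= expr1; case/orP => [|/eqP ->]; last by rewrite mulr0.
by rewrite expf_eq0 => /andP[_ /eqP ->]; rewrite mulr0 mul0r.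
Qed.

(** * Comparison of the sprays at regular points, and of the geodesics *)

Lemma smooth_on_derivable (R : realType) (V W : normedModType R) (U : set V)
    (f : V -> W) (x v : V) : smooth_on U f -> U x -> derivable f x v.
Proof. by move=> /(_ 1%N) [_ /(_ v) [df _]]; exact: df. Qed.

Lemma smooth_on_derive (R : realType) (V W : normedModType R) (U : set V)
    (f : V -> W) (v : V) : smooth_on U f -> smooth_on U ('D_v f).
Proof. by move=> fU k; have [_ /(_ v) []] := fU k.+1. Qed.

Lemma root_spray (R : realType) (n : nat) (M : topologicalType)
    (A : set (chart R n M)) (gamma : chart R n M -> 'rV[R]_n -> 'M[R]_n)
    (k : nat) (alpha T : chart R n M -> tcoord R n -> R^o)
    (phi : chart R n M) (z : tcoord R n) :
  riemannian_metric A gamma ->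
  (forall phi (i : 'I_n) z, A phi -> timg phi z ->
     covariant_derivative (gamma phi) (alpha phi) i z = 0) ->
  (forall phi z, T phi z = alpha phi z * bilin (gamma phi z.1) z.2 z.2) ->
  root_metric A k T -> A phi -> root_regular k T phi z ->
  finsler_spray (root_function k T phi) z = riemannian_spray (gamma phi) z.
Proof.
move=> hgamma hcov hT hF Aphi regz.
have FU := root_nondegenerate hF Aphi regz.
case: (regz) => z0 [ O [[Oo Oz] Oimg Odef Fsm]].
have nbO w : O w -> \forall u \near w, O u by move=> Ow; exact: open_nbhs_nbhs.
have gsym w : O w -> \forall x \near w.1, (gamma phi x)^T = gamma phi x.
  move=> Ow; have : open_nbhs w.1 (cimg phi).
    by split; [exact: cimg_open | exact: Oimg].
  move/open_nbhs_nbhs; apply: filterS => x.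
  exact: (Defs.metric_sym hgamma Aphi).
have gpos w : O w -> w.2 != 0 -> 0 < bilin (gamma phi w.1) w.2 w.2.
  by move=> Ow; apply: (metric_posdef hgamma) => //; exact: Oimg.
have gU w : O w -> gamma phi w.1 \in unitmx.
  move=> Ow; apply: posdef_unitmx => y.
  by apply: (metric_posdef hgamma) => //; exact: Oimg.
have dg w v i j : O w ->
    derivable ((fun x => gamma phi x i j) : 'rV[R]_n -> R^o) w.1 v.
  move=> Ow; apply: smooth_on_derivable (metric_smooth hgamma i j Aphi) _.
  exact: Oimg.
apply: finsler_spray_riemannian => //.
- exact: gsym.
(* Both [O] and the complement of the zero section are open, so the argument at [z] applies at every
   nearby [w]. *)
- move=> i; have := near_slit _ _ _ z0; apply: filterS2 (nbO _ Oz) => w Ow w0.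
  apply: (@covariant_derivative_sqr_root _ _ _ _ (alpha phi)
    (fun w => bilin (gamma phi w.1) w.2 w.2) k).
  + by apply: leq_trans (root_order hF).
  (* For even order, [kroot] inverts the power only on nonnegative values; [Odef] ensures that the
     root is a true one on [O]. *)
  + apply: filterS (nbO _ Ow) => u Ou; rewrite -hT krootK //.
      by apply: leq_trans (root_order hF).
    exact: Odef.
  + have := near_slit _ _ _ w0; apply: filterS2 (nbO _ Ow) => u Ou u0.
    exact/lt0r_neq0/gpos.
  + by move=> j; split; exact: smooth_on_derivable Fsm Ow.
  + move=> j; split; apply: ex_derive.
      by apply: is_derive_bilin_x => *; exact: dg.
    by apply: is_derive_bilin_y; exact: nbhs_singleton (gsym _ Ow).
  + by apply: hcov => //; exact: Oimg.
  + by apply: metric_compatible; [exact: gsym | exact: gU | move=> *; exact: dg].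
- move=> r l; set F := root_function k T phi.
  (* Near [z], [L_{y^r}] is [2 F F_{y^r}], a product of functions smooth on [O]. *)
  apply: (@near_eq_derivable _ _ _
    ((2 \*o F) * ('D_((0, basis_vec R r) : tcoord R n) F))).
    apply: filterS (nbO _ Oz) => w Ow; rewrite /dy.
    rewrite -[(fun w => F w ^+ 2)]/(F ^+ 2) deriveX //.
    exact: smooth_on_derivable Fsm Ow.
  apply: derivableM; last exact: smooth_on_derivable (smooth_on_derive _ _ _ _ _ _ Fsm) Oz.
  apply: derivableZ; exact: smooth_on_derivable Fsm Oz.
Qed.

Theorem proposition22 (R : realType) (n : nat) (M : topologicalType)
    (A : set (chart R n M)) (hM : smooth_manifold A)
    (gamma : chart R n M -> 'rV[R]_n -> 'M[R]_n)
    (hgamma : riemannian_metric A gamma)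
    (hflat : riemannian_projectively_flat A gamma)
    (m : nat) (hm : (0 < m)%N)
    (alpha : chart R n M -> tcoord R n -> R^o)
    (halpha : homogeneous_polynomial A m alpha)
    (hcov : forall phi (i : 'I_n) z, A phi -> timg phi z ->
       covariant_derivative (gamma phi) (alpha phi) i z = 0)
    (T : chart R n M -> tcoord R n -> R^o)
    (hT : forall phi z,
       T phi z = alpha phi z * bilin (gamma phi z.1) z.2 z.2)
    (hF : root_metric A m.+2 T) :
  root_projectively_flat A m.+2 T.
Proof.
(* The chart that straightens the geodesics of [gamma] also serves for [F]. *)
move=> p; have [phi [Aphi phip flat]] := hflat p; exists phi; split => //.
move=> a b c ab [c_cont c_geo]; apply: flat => //; split => // psi t Apsi tab ct.
(* Regular points have [y != 0], so the velocity lies in the domain of the Riemannian spray. *)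
have [dx dx' reg eqn] := c_geo psi t Apsi tab ct; split => //; first by case: reg.
by rewrite -(root_spray _ _ _ _ _ _ _ _ _ _ hgamma hcov hT hF Apsi reg).
Qed.
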